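(* For every $n\ge1$, the restriction of $\pi_\downarrow^{3412}$ is an isomorphism of posets from the weak order on $S_n$ restricted to Baxter permutations to the weak order on $S_n$ restricted to twisted Baxter permutations. The inverse isomorphism is (the restriction of) $\pi^\uparrow_{3412}$. In particular, the weak order restricted to Baxter permutations in $S_n$ is a lattice.
   Context: Permutations are in one-line notation $x=x_1\cdots x_n\in S_n$. Patterns, always with $a<b<c<d$: $x$ contains 3-41-2 if it has a subsequence $c\,d\,a\,b$ with $d$ immediately before $a$ in $x$; 2-41-3 if it has a subsequence $b\,d\,a\,c$ with $d$ immediately before $a$; 3-14-2 if it has a subsequence $c\,a\,d\,b$ with $a$ immediately before $d$. A Baxter permutation is one avoiding both 3-14-2 and 2-41-3; a twisted Baxter permutation is one avoiding both 3-41-2 and 2-41-3. The weak order on $S_n$ is the partial order in which one moves up by a cover by swapping adjacent entries $x_i<x_{i+1}$; it is a lattice. Restricting it to a subset means taking the induced subposet. A permutation $x$ is obtained from $y$ by a $(3412\to3142)$-move if $y$ has a subsequence $c\,d\,a\,b$ as in the pattern 3-41-2 and $x$ is $y$ with the adjacent entries $d,a$ swapped. $\Theta_{3412}$ is the lattice congruence on the weak order on $S_n$ such that, for a cover $x\lessdot y$, $x\equiv y$ if and only if $x$ is obtained from $y$ by a $(3412\to3142)$-move; its classes are intervals, so it is the equivalence relation generated by these moves (that it is a lattice congruence is known). $\pi_\downarrow^{3412}$ sends a permutation to the minimal element of its $\Theta_{3412}$-class, and $\pi^\uparrow_{3412}$ sends it to the maximal element of its class. *)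

(* Defs.v *)
From mathcomp Require Import all_boot all_fingroup.

Set Implicit Arguments.
Unset Strict Implicit.
Unset Printing Implicit Defensive.

Local Open Scope group_scope.

(* x : 'S_n is read in one-line notation x 0, x 1, ..., x (n-1), with positions
   and values counted from 0. *)

(* Positions of a vincular pattern of shape p-qr-s: the two middle entries are
   adjacent. *)
Definition vincular n (i j k l : 'I_n) : bool :=
  [&& i < j, k == j.+1 :> nat & k < l].

Definition occurs_3_41_2 n (x : 'S_n) (i j k l : 'I_n) : bool :=
  vincular i j k l && [&& x k < x l, x l < x i & x i < x j].

Definition occurs_2_41_3 n (x : 'S_n) (i j k l : 'I_n) : bool :=
  vincular i j k l && [&& x k < x i, x i < x l & x l < x j].

Definition occurs_3_14_2 n (x : 'S_n) (i j k l : 'I_n) : bool :=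
  vincular i j k l && [&& x j < x l, x l < x i & x i < x k].

Definition contains n (occ : 'S_n -> 'I_n -> 'I_n -> 'I_n -> 'I_n -> bool)
    (x : 'S_n) : bool :=
  [exists i, exists j, exists k, exists l, occ x i j k l].

Definition Baxter n : {set 'S_n} :=
  [set x | ~~ contains (@occurs_3_14_2 n) x
         & ~~ contains (@occurs_2_41_3 n) x].

Definition twisted_Baxter n : {set 'S_n} :=
  [set x | ~~ contains (@occurs_3_41_2 n) x
         & ~~ contains (@occurs_2_41_3 n) x].

(* (s * t) i = t (s i) in {perm _}, so tperm i j * x is x with the entries in
   positions i and j exchanged. *)
Definition swap_entries n (i j : 'I_n) (x : 'S_n) : 'S_n := tperm i j * x.

Definition weak_cover n : rel 'S_n := fun x y =>
  [exists i : 'I_n, exists j : 'I_n,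
    [&& j == i.+1 :> nat, x i < x j & y == swap_entries i j x]].

Definition weak_le n : rel 'S_n := connect (@weak_cover n).

(* x is obtained from y by a (3412 -> 3142)-move. *)
Definition move_3412_3142 n : rel 'S_n := fun x y =>
  [exists i, exists j, exists k, exists l,
    occurs_3_41_2 y i j k l && (x == swap_entries j k y)].

(* The congruence, as the equivalence relation generated by the moves. *)
Definition Theta_3412 n : rel 'S_n :=
  connect (fun x y => move_3412_3142 x y || move_3412_3142 y x).

(* The classes of Theta_3412 are intervals of the weak order, so both picks
   succeed and the default value x is never used. *)
Definition pi_down_3412 n (x : 'S_n) : 'S_n :=
  odflt x [pick y | Theta_3412 x y
                  & [forall z, Theta_3412 x z ==> weak_le y z]].

Definition pi_up_3412 n (x : 'S_n) : 'S_n :=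
  odflt x [pick y | Theta_3412 x y
                  & [forall z, Theta_3412 x z ==> weak_le z y]].

(* f restricts to an isomorphism from A to B, as subposets of (T, le). *)
Definition poset_iso_on (T : finType) (le : rel T) (A B : {set T})
    (f : T -> T) : Prop :=
  [/\ {in A &, injective f}, f @: A = B
    & {in A &, forall x y, le (f x) (f y) = le x y}].

Definition is_join_on (T : finType) (le : rel T) (A : {set T}) (x y z : T) :=
  [/\ z \in A, le x z, le y z
    & {in A, forall u, le x u -> le y u -> le z u}].

Definition is_meet_on (T : finType) (le : rel T) (A : {set T}) (x y z : T) :=
  [/\ z \in A, le z x, le z y
    & {in A, forall u, le u x -> le u y -> le u z}].

Definition is_partial_order_on (T : finType) (le : rel T) (A : {set T}) :=
  [/\ {in A, reflexive le}, {in A &, antisymmetric le}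
    & {in A & &, transitive le}].

Definition is_lattice_on (T : finType) (le : rel T) (A : {set T}) : Prop :=
  [/\ is_partial_order_on le A,
      {in A &, forall x y, exists z, is_join_on le A x y z}
    & {in A &, forall x y, exists z, is_meet_on le A x y z}].

(* Main.v *)
(* A class of Theta is obtained from its bottom by the moves 3-14-2 -> 3-41-2,
   so its bottom avoids 3-41-2 and its top avoids 3-14-2.  If w avoids 3-41-2,
   w <= y and y -> x is a downward move, then w <= x; hence the bottom of the
   class of y is the largest 3-41-2-avoiding permutation below y, and pi_down is
   monotone.  Reversing words gives the same for pi_up.  The same argument for
   both downward moves 3-41-2 and 2-41-3 makes twisted Baxter permutations the
   image of an interior operator on the weak order, hence a lattice.

   It remains to see that the top of a class contains 2-41-3 iff its bottom does.
   An occurrence can be taken of the form B DA B+1.  In the bottom, avoidance of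
   3-41-2 puts A..B before B+1 and B before B+1..D, and upward moves preserve
   this, so the top still has B .. D .. A .. B+1.  In the top, let b < B be the
   largest entry weakly to the right of A, and c > B+1 the smallest one weakly to
   the left of D; avoidance of 3-14-2 gives B .. c .. b .. B+1, which downward
   moves preserve.  In both cases some descent between the middle two entries
   jumps over B and B+1. *)
Require Import Defs.
From mathcomp Require Import all_boot all_fingroup.
From mathcomp Require Import zify.

Set Implicit Arguments.
Unset Strict Implicit.
Unset Printing Implicit Defensive.

Local Open Scope group_scope.

(** * Preliminaries on reflexive transitive closures and counting *)

Lemma connect_ind (T : finType) (e : rel T) (R : T -> T -> Prop) :
  (forall x, R x x) -> (forall x y z, R x y -> R y z -> R x z) ->
  (forall x y, e x y -> R x y) -> forall x y, connect e x y -> R x y.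
Proof.
move=> Rxx Rtr eR x y /connectP[s sP ->] {y}.
elim: s x sP => [|z s IHs] x //= /andP[/eR xz /IHs]; exact: Rtr.
Qed.

Lemma card_ord_lt n k : k <= n -> #|[set i : 'I_n | i < k]| = k.
Proof.
move=> le_kn; rewrite -sum1_card (eq_bigl (fun i : 'I_n => i < k)).
  by rewrite -(big_ord_widen n (fun=> 1%N) le_kn) sum1_card card_ord.
by move=> i; rewrite inE.
Qed.

(** * Positions of values and exchange of neighbours *)

Section Perms.

Variable n : nat.
Implicit Types (x y z w : 'S_n) (u v p q a b c d s t : 'I_n).

(** Entries are named by value throughout and compared by position; the codomain is [nat] so that
    [lia] applies. *)
Definition pos x v : nat := x^-1 v.

Lemma pos_eq x u v : (pos x u == pos x v) = (u == v :> nat).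
Proof. by rewrite /pos !(inj_eq val_inj) (inj_eq perm_inj). Qed.

Lemma pos_perm x (i : 'I_n) : pos x (x i) = i.
Proof. by rewrite /pos permK. Qed.

Lemma pos_lt x u : pos x u < n.
Proof. exact: ltn_ord. Qed.

Lemma pos_ext x y : (forall v, pos x v = pos y v) -> x = y.
Proof. by move=> eq_pos; apply/invg_inj/permP => v; apply/val_inj/eq_pos. Qed.

Lemma pos_at x k : k < n -> exists u, pos x u = k.
Proof. by move=> lt_kn; exists (x (Ordinal lt_kn)); rewrite pos_perm. Qed.

(** A discrete intermediate value argument: [s] is the last entry before [v] that satisfies [P]. It
    supplies the adjacent pairs needed for covers and patterns. *)
Lemma crossing x (P : pred 'I_n) u v :
    pos x u < pos x v -> P u -> ~~ P v ->
  exists s t, [/\ P s, ~~ P t, pos x t = (pos x s).+1,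
                  pos x u <= pos x s & pos x t <= pos x v].
Proof.
move=> lt_uv Pu nPv.
have Qu : P u && (pos x u < pos x v) by rewrite Pu.
case: (@arg_maxnP _ u (fun s => P s && (pos x s < pos x v)) (pos x) Qu).
move=> s /andP[Ps lt_sv] s_max.
have [|t tE] := @pos_at x (pos x s).+1; first by have := pos_lt x v; lia.
exists s, t; split=> //; try by have := s_max u Qu; lia.
apply/negP => Pt.
have : t != v by apply: contraTneq Pt => ->.
rewrite -(inj_eq val_inj) /= -(pos_eq x) => ne_tv.
have := s_max t; rewrite Pt /= => /(_ _); lia.
Qed.

Definition vswap x u v := swap_entries (x^-1 u) (x^-1 v) x.

Lemma pos_vswap x u v t : pos (vswap x u v) t =
  if t == u :> nat then pos x v else if t == v :> nat then pos x u else pos x t.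
Proof.
rewrite /pos /vswap /swap_entries invMg tpermV permM.
rewrite !(inj_eq val_inj) -(inj_eq (@perm_inj _ x^-1) t u) -(inj_eq (@perm_inj _ x^-1) t v).
by case: tpermP => [->|->|/eqP/negPf-> /eqP/negPf->] //; rewrite ?eqxx //; case: eqP => // ->.
Qed.

Lemma pos_vswap_lt x s t u v : pos x t = (pos x s).+1 ->
  (pos (vswap x s t) u < pos (vswap x s t) v) =
  ((u == t :> nat) && (v == s :> nat))
  || ((pos x u < pos x v) && ~~ ((u == s :> nat) && (v == t :> nat))).
Proof.
move=> adj; rewrite !pos_vswap.
rewrite -(pos_eq x u s) -(pos_eq x u t) -(pos_eq x v s) -(pos_eq x v t).
move: (pos x u) (pos x v) (pos x s) (pos x t) adj => U V S T ->.
by case: (U =P S) => [->|?]; case: (V =P S) => [->|?];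
  case: (U =P S.+1) => ?; case: (V =P S.+1) => ?; lia.
Qed.

Lemma weak_coverP x y :
  reflect (exists s t, [/\ s < t, pos x t = (pos x s).+1 & y = vswap x s t])
    (weak_cover x y).
Proof.
apply: (iffP existsP) => [[i /existsP[j /and3P[/eqP ij lt_ij /eqP->]]]|].
  by exists (x i), (x j); rewrite !pos_perm /vswap !permK.
move=> [s [t [lt_st adj ->]]]; exists (x^-1 s); apply/existsP; exists (x^-1 t).
by rewrite !permKV lt_st eqxx andbT; apply/andP; split=> //; apply/eqP.
Qed.

(** * The weak order as inclusion of inversion sets *)

Definition ninv x := #|[set u : 'I_n * 'I_n | (u.1 < u.2) && (pos x u.2 < pos x u.1)]|.

Lemma ninv_vswap x s t : s < t -> pos x t = (pos x s).+1 -> ninv x < ninv (vswap x s t).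
Proof.
move=> lt_st adj; apply: proper_card; apply/properP; split.
  by apply/subsetP => -[u v]; rewrite !inE /= pos_vswap_lt //; lia.
by exists (s, t); rewrite !inE /= ?pos_vswap_lt //; lia.
Qed.

Definition inv_le x y := forall a d, a < d -> pos x d < pos x a -> pos y d < pos y a.

Lemma inv_leNP x y a d : inv_le x y -> a < d -> pos y a < pos y d -> pos x a < pos x d.
Proof.
move=> le_xy lt_ad lt_y; have := le_xy _ _ lt_ad; have := pos_eq x a d; lia.
Qed.

(** Some pair is ordered oppositely by [x] and [y]. Between its entries in [x], the position in [y]
    must drop at some pair of neighbours, which is then an ascent of [x] inverted by [y]. *)
Lemma inv_le_cover x y : inv_le x y -> x != y ->
  exists s t, [/\ s < t, pos x t = (pos x s).+1 & inv_le (vswap x s t) y].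
Proof.
move=> le_xy ne_xy.
have [a [d [lt_x lt_y]]] : exists a d, pos x a < pos x d /\ pos y d < pos y a.
  have [/existsP[a /existsP[d /andP[? ?]]]|no_ad] :=
    boolP [exists a, exists d, (pos x a < pos x d) && (pos y d < pos y a)].
    by exists a, d.
  case/eqP: ne_xy.
  have mono : forall a d, (pos x a < pos x d) = (pos y a < pos y d).
    move=> a d; have nn u v : ~~ ((pos x u < pos x v) && (pos y v < pos y u)).
      by apply: contra no_ad => H; apply/existsP; exists u; apply/existsP; exists v.
    have := (nn a d, nn d a, pos_eq x a d, pos_eq y a d) => -[[[]]]; lia.
  (* A position counts the entries before it, so equal relative orders force equal permutations. *)
  have posE z v : pos z v = #|[set u | pos z u < pos z v]|.
    have /= -> : [set u | pos z u < pos z v] = z @: [set i : 'I_n | i < pos z v].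
      apply/setP => u; apply/idP/imsetP => [|[i]]; rewrite !inE.
        by move=> ?; exists (z^-1 u); rewrite ?permKV // inE.
      by move=> ? ->; rewrite pos_perm.
    rewrite card_imset; last exact: perm_inj.
    by rewrite card_ord_lt // ltnW // pos_lt.
  apply: pos_ext => v; rewrite [LHS]posE [RHS]posE.
  by apply: eq_card => u; rewrite !inE mono.
have [|s [t [Ps Pt adj _ _]]] :=
  crossing (P := fun v => pos y a <= pos y v) lt_x (leqnn _); first lia.
have lt_ts : pos y t < pos y s by lia.
have lt_st : s < t.
  have := le_xy t s; have := pos_eq x s t; have := pos_eq y s t; lia.
exists s, t; split=> // u v lt_uv; rewrite pos_vswap_lt //.
have := le_xy u v lt_uv => H /orP[/andP[/eqP/val_inj-> /eqP/val_inj->]|]; lia.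
Qed.

Lemma weak_le_vswap x s t : s < t -> pos x t = (pos x s).+1 -> weak_le x (vswap x s t).
Proof. by move=> ? ?; apply/connect1/weak_coverP; exists s, t. Qed.

(** For the converse, climb from [x] by the covers of [inv_le_cover]; each adds an inversion, and
    [ninv y] bounds their number. *)
Lemma weak_leP x y : reflect (inv_le x y) (weak_le x y).
Proof.
apply: (iffP idP) => [|le_xy].
  apply: (connect_ind (R := inv_le)) => [z a d //|u v z uv vz a d ad lt_u|].
    by apply: vz => //; apply: uv.
  move=> {}x {}y /weak_coverP[s [t [lt_st adj ->]]] a d lt_ad.
  rewrite pos_vswap_lt //; lia.
have [k] := ubnP (ninv y - ninv x); elim: k x le_xy => // k IHk x le_xy lt_k.
have [->|ne_xy] := eqVneq x y; first exact: connect0.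
have [s [t [lt_st adj le_y]]] := inv_le_cover le_xy ne_xy.
apply: connect_trans (weak_le_vswap lt_st adj) _; apply: IHk => //.
have := ninv_vswap lt_st adj.
have : ninv (vswap x s t) <= ninv y.
  apply: subset_leq_card; apply/subsetP => -[a d]; rewrite !inE /=.
  by move=> /andP[ad /(le_y _ _ ad)->]; rewrite ad.
lia.
Qed.

Lemma weak_le_refl : reflexive (@weak_le n).
Proof. exact: connect0. Qed.

Lemma weak_le_trans : transitive (@weak_le n).
Proof. exact: connect_trans. Qed.

Lemma weak_le_antisym : antisymmetric (@weak_le n).
Proof.
move=> x y /andP[/weak_leP le_xy /weak_leP le_yx].
apply/eqP; apply: contraT => /(inv_le_cover le_xy)[s [t [lt_st adj le_y]]].
have := le_y s t lt_st; rewrite pos_vswap_lt // !eqxx => /(_ isT) /(le_yx _ _ lt_st).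
lia.
Qed.

(** * Reversal of words, an antiautomorphism of the weak order *)

Definition reverse x : 'S_n := perm (@rev_ord_inj n) * x.

Lemma pos_reverse x v : pos (reverse x) v = n - (pos x v).+1.
Proof.
rewrite /pos /reverse invMg permM; set i := x^-1 v.
have {1}-> : i = perm (@rev_ord_inj n) (rev_ord i) by rewrite permE rev_ordK.
by rewrite permK.
Qed.

Lemma pos_reverse_lt x u v : (pos (reverse x) u < pos (reverse x) v) = (pos x v < pos x u).
Proof. by rewrite !pos_reverse; have := (pos_lt x u, pos_lt x v) => -[]; lia. Qed.

Lemma reverseK : involutive reverse.
Proof. by move=> x; apply: pos_ext => v; rewrite !pos_reverse; have := pos_lt x v; lia. Qed.

Lemma reverse_vswap x u v : reverse (vswap x u v) = vswap (reverse x) v u.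
Proof.
apply: pos_ext => t; rewrite pos_reverse !pos_vswap !pos_reverse.
by case: eqP => [/val_inj->|_]; case: eqP => // /val_inj->.
Qed.

Lemma weak_le_reverse x y : weak_le (reverse x) (reverse y) = weak_le y x.
Proof.
apply/weak_leP/weak_leP => le_xy a d lt_ad; last first.
  by rewrite !pos_reverse_lt; apply: inv_leNP.
by have := inv_leNP le_xy lt_ad; rewrite !pos_reverse_lt.
Qed.

Lemma pos_vswapL x u v : pos (vswap x u v) u = pos x v.
Proof. by rewrite pos_vswap eqxx. Qed.

Lemma pos_vswapR x u v : pos (vswap x u v) v = pos x u.
Proof. by rewrite pos_vswap eqxx; case: eqP => // /val_inj->. Qed.

Lemma pos_vswapD x u v t : t != u :> nat -> t != v :> nat -> pos (vswap x u v) t = pos x t.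
Proof. by rewrite pos_vswap => /negPf-> /negPf->. Qed.

Lemma vswapK x u v : vswap (vswap x u v) v u = x.
Proof.
apply: pos_ext => t; rewrite pos_vswap.
case: eqP => [/val_inj->|/eqP ?]; first by rewrite pos_vswapL.
case: eqP => [/val_inj->|/eqP ?]; first by rewrite pos_vswapR.
by rewrite pos_vswapD.
Qed.

(** * Joins and meets in the weak order *)

Lemma weak_le_vswapE x y s t : s < t -> pos x t = (pos x s).+1 ->
  weak_le (vswap x s t) y = weak_le x y && (pos y t < pos y s).
Proof.
move=> lt_st adj; apply/idP/andP => [le_y|[/weak_leP le_xy lt_y]].
  split; first exact: weak_le_trans (weak_le_vswap lt_st adj) le_y.
  by apply: (weak_leP _ _ le_y); rewrite // pos_vswapL pos_vswapR adj.
apply/weak_leP => u v lt_uv; rewrite pos_vswap_lt //.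
by case/orP=> [/andP[/eqP/val_inj-> /eqP/val_inj->] //|/andP[/(le_xy _ _ lt_uv)]].
Qed.

Definition has_join x y := exists z,
  [/\ weak_le x z, weak_le y z & forall w, weak_le x w -> weak_le y w -> weak_le z w].

Lemma has_joinC x y : has_join x y -> has_join y x.
Proof. by case=> z [xz yz zP]; exists z; split=> // w yw xw; apply: zP. Qed.

(** Distinct covers swap disjoint ascents, which commute, or overlap in three increasing consecutive
    entries [s t v]. In the latter case the join reverses all three: inverting [(s, t)] and [(t, v)]
    forces inverting [(s, v)]. *)
Lemma has_join_covers z s t u v :
    s < t -> pos z t = (pos z s).+1 -> u < v -> pos z v = (pos z u).+1 ->
  has_join (vswap z s t) (vswap z u v).
Proof.
wlog lt_su : s t u v / pos z s < pos z u => [IH|] lt_st adj_st lt_uv adj_uv.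
  have [lt_su|lt_us|eq_su] := ltngtP (pos z s) (pos z u); first exact: IH.
    exact/has_joinC/IH.
  have eq_tv : pos z t = pos z v by rewrite adj_st adj_uv eq_su.
  move/eqP: eq_su eq_tv; rewrite pos_eq => /eqP/val_inj-> /eqP.
  rewrite pos_eq => /eqP/val_inj->.
  by exists (vswap z u v); split=> //; apply: weak_le_refl.
have [ne_su ne_sv ne_tv] : [/\ s != u :> nat, s != v :> nat & t != v :> nat].
  by split; rewrite -(pos_eq z); lia.
have [eq_tu|ne_tu] := eqVneq t u; last first.
  have {}ne_tu : t != u :> nat by [].
  have adj : pos (vswap z s t) v = (pos (vswap z s t) u).+1.
    by rewrite !pos_vswapD // eq_sym.
  exists (vswap (vswap z s t) u v); split; first exact: weak_le_vswap.
    rewrite weak_le_vswapE // pos_vswapL pos_vswapR adj leqnn andbT.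
    exact: weak_le_trans (weak_le_vswap _ _) (weak_le_vswap _ adj).
  by move=> w; rewrite !weak_le_vswapE // => -> /andP[_ ->].
subst u; have lt_sv : s < v by lia.
(* The word passes from [s t v] through [t s v] and [t v s] to [v t s]. *)
set x1 := vswap z s t; have x1s : pos x1 s = (pos z s).+1 by rewrite pos_vswapL.
have x1t : pos x1 t = pos z s by rewrite pos_vswapR.
have x1v : pos x1 v = (pos z s).+2 by rewrite pos_vswapD // 1?eq_sym // adj_uv adj_st.
have adj1 : pos x1 v = (pos x1 s).+1 by rewrite x1v x1s.
have adj2 : pos (vswap x1 s v) v = (pos (vswap x1 s v) t).+1.
  by rewrite pos_vswapR pos_vswapD // 1?eq_sym // x1s x1t.
have le_x1 : weak_le x1 (vswap (vswap x1 s v) t v).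
  exact: weak_le_trans (weak_le_vswap _ _) (weak_le_vswap _ adj2).
exists (vswap (vswap x1 s v) t v); split=> //.
  rewrite weak_le_vswapE // pos_vswapL pos_vswapR adj2 leqnn andbT.
  exact: weak_le_trans (weak_le_vswap _ _) le_x1.
move=> w; rewrite !weak_le_vswapE // => /andP[-> lt_ts] /andP[_ lt_vt].
by rewrite lt_ts lt_vt (ltn_trans lt_vt).
Qed.

Lemma ninv_le x : ninv x <= n * n.
Proof. by rewrite (leq_trans (max_card _)) // card_prod !card_ord. Qed.

(* Bjorner, Edelman and Ziegler: joins of pairs of covers of a common element
   suffice. *)
Lemma has_join_above z x y : weak_le z x -> weak_le z y -> has_join x y.
Proof.
have [k] := ubnP (n * n - ninv z); elim: k z x y => // k IHk z x y lt_k le_zx le_zy.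
have [<-|ne_x] := eqVneq z x; first by exists y; split=> //; apply: weak_le_refl.
have [<-|ne_y] := eqVneq z y; first by exists x; split=> //; apply: weak_le_refl.
have [s [t [lt_st adj_st /weak_leP le_x]]] := inv_le_cover (weak_leP _ _ le_zx) ne_x.
have [u [v [lt_uv adj_uv /weak_leP le_y]]] := inv_le_cover (weak_leP _ _ le_zy) ne_y.
have [c [le1c le2c cP]] := has_join_covers lt_st adj_st lt_uv adj_uv.
have := (ninv_vswap lt_st adj_st, ninv_vswap lt_uv adj_uv).
have := (ninv_le (vswap z s t), ninv_le (vswap z u v)) => -[? ?] [? ?].
(* First [e] joins [x] and [c] above the cover [vswap z s t], then [f] joins [e] and [y] above
   [vswap z u v]; both bases have more inversions than [z]. *)
have [|e [le_xe le_ce eP]] := IHk (vswap z s t) x c _ le_x le1c; first lia.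
have [|f [le_ef le_yf fP]] := IHk (vswap z u v) e y _ (weak_le_trans le2c le_ce) le_y.
  lia.
exists f; split=> // [|w le_xw le_yw]; first exact: weak_le_trans le_xe le_ef.
apply: fP => //; apply: eP => //.
by apply: cP; [apply: weak_le_trans le_xw | apply: weak_le_trans le_yw].
Qed.

Lemma weak_join x y : has_join x y.
Proof.
(* The identity has no inversions, so it lies below every permutation. *)
apply: (@has_join_above 1); apply/weak_leP => a d lt_ad; rewrite /pos invg1 !perm1; lia.
Qed.

Lemma weak_meet x y : exists z,
  [/\ weak_le z x, weak_le z y & forall w, weak_le w x -> weak_le w y -> weak_le w z].
Proof.
have [z [xz yz zP]] := weak_join (reverse x) (reverse y); exists (reverse z).
by split=> [||w wx wy]; rewrite -weak_le_reverse reverseK // zP // weak_le_reverse.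
Qed.

(** * Vincular patterns in terms of values *)

(* Entries p, d, a, q in this order with d a adjacent: 3-41-2 when phi is >,
   2-41-3 when phi is <, either of them when phi is always true. *)
Definition pat (phi : rel nat) x p d a q :=
  [&& pos x p < pos x d, pos x a == (pos x d).+1, pos x a < pos x q,
      a < p, p < d, a < q, q < d & phi p q].

Definition has_pat phi x := [exists p, exists d, exists a, exists q, pat phi x p d a q].

Lemma has_patP phi x : reflect (exists p d a q, pat phi x p d a q) (has_pat phi x).
Proof.
apply: (iffP existsP) => [[p /existsP[d /existsP[a /existsP[q h]]]]|[p [d [a [q h]]]]].
  by exists p, d, a, q.
by exists p; apply/existsP; exists d; apply/existsP; exists a; apply/existsP; exists q.
Qed.

(** The middle entries need not be adjacent: from [d] to [a] the word passes from above both [p] and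
    [q] to below both, and [gap] forces some descent of neighbours to jump over both. *)
Lemma has_pat_gap (phi : rel nat) x p q a d :
    pos x p < pos x d -> pos x d < pos x a -> pos x a < pos x q ->
    a < p < d -> a < q < d -> phi p q ->
    (forall t, pos x d < pos x t < pos x a -> (t < p) && (t < q) || (p < t) && (q < t)) ->
  has_pat phi x.
Proof.
move=> lt_pd lt_da lt_aq /andP[ap pd] /andP[aq qd] phi_pq gap.
have [|||s [t [Ps Pt adj le_s le_t]]] :=
  @crossing x (fun v => (p < v) && (q < v)) d a; try lia.
apply/has_patP; exists p, s, t, q.
have lt_t : (t < p) && (t < q).
  have [eq_ta|ne_ta] := eqVneq (t : nat) a; first by lia.
  have := gap t; rewrite -(pos_eq x) in ne_ta; lia.
rewrite /pat phi_pq; lia.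
Qed.

(** * Downward rewriting and its normal forms *)

(** The source comes first, so a path of steps reads downward; [move_3412_3142] takes its arguments
    in the opposite order. *)
Definition step phi : rel 'S_n := fun y x =>
  [exists p, exists d, exists a, exists q, pat phi y p d a q && (x == vswap y d a)].

Lemma stepP phi y x :
  reflect (exists p d a q, pat phi y p d a q /\ x = vswap y d a) (step phi y x).
Proof.
apply: (iffP existsP).
  by move=> [p /existsP[d /existsP[a /existsP[q /andP[h /eqP->]]]]]; exists p, d, a, q.
move=> [p [d [a [q [h ->]]]]].
exists p; apply/existsP; exists d; apply/existsP; exists a; apply/existsP; exists q.
by rewrite h eqxx.
Qed.

Lemma step_cover phi y x : step phi y x -> weak_le x y && (ninv x < ninv y).
Proof.
move=> /stepP[p [d [a [q [/and4P[_ /eqP adj _ h] ->]]]]].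
have lt_ad : a < d by lia.
have adj' : pos (vswap y d a) d = (pos (vswap y d a) a).+1.
  by rewrite pos_vswapL pos_vswapR.
by have := (weak_le_vswap lt_ad adj', ninv_vswap lt_ad adj'); rewrite vswapK => -[-> ->].
Qed.

Lemma steps_le phi y x : connect (step phi) y x -> weak_le x y.
Proof.
apply: (connect_ind (R := fun y x => weak_le x y)) => [z|u v w vu wv|u v /step_cover/andP[]//].
  exact: weak_le_refl.
exact: weak_le_trans wv vu.
Qed.

Lemma steps_normal phi y : exists x, connect (step phi) y x /\ ~~ has_pat phi x.
Proof.
have [k] := ubnP (ninv y); elim: k y => // k IHk y lt_k.
have [/has_patP[p [d [a [q h]]]]|no_pat] := boolP (has_pat phi y); last first.
  by exists y; split.
have st : step phi y (vswap y d a) by apply/stepP; exists p, d, a, q.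
have /andP[_ lt_n] := step_cover st.
have [|x [yx nx]] := IHk (vswap y d a); first lia.
by exists x; split=> //; apply: connect_trans (connect1 st) yx.
Qed.

(** If [w] inverted [(a, d)], it would have [p] before [d] and [a] before [q], as [y] has. A value
    strictly between [a] and [d] standing between them in [w] would do so in [y] too, against
    adjacency. So [has_pat_gap] would give a pattern in [w], and the swap loses no inversion of
    [w]. *)
Lemma step_maximal phi w y x : ~~ has_pat phi w -> step phi y x ->
  weak_le w y -> weak_le w x.
Proof.
move=> nw /stepP[p [d [a [q [h ->]]]]] /weak_leP le_wy.
case/and4P: h => lt_pd /eqP adj lt_aq /and5P[ap pd aq qd phi_pq].
have nad : ~~ (pos w d < pos w a).
  apply: contra nw => lt_da; apply: (has_pat_gap (p := p) (q := q) (a := a) (d := d)) => //.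
  - exact: inv_leNP lt_pd.
  - exact: inv_leNP lt_aq.
  - by rewrite ap.
  - by rewrite aq.
  move=> t /andP[dt ta].
  have := le_wy t d; have := le_wy a t; rewrite dt ta; lia.
apply/weak_leP => u v lt_uv lt_vu; rewrite pos_vswap_lt //.
rewrite (le_wy _ _ lt_uv lt_vu) /=; apply/orP; right.
by apply: contra nad => /andP[/eqP/val_inj<- /eqP/val_inj<-].
Qed.

(** Thus a normal form of [y] is the largest pattern-free permutation below [y]. *)
Lemma steps_maximal phi w y x : ~~ has_pat phi w -> connect (step phi) y x ->
  weak_le w y -> weak_le w x.
Proof.
move=> nw; apply: (connect_ind (R := fun y x => weak_le w y -> weak_le w x)) => //.
  by move=> u v z uv vz /uv/vz.
by move=> u v; apply: step_maximal.
Qed.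

(** * Translation of the given patterns and moves *)

Local Notation desc := (fun p q : nat => q < p).

Lemma containsI (occ : 'S_n -> 'I_n -> 'I_n -> 'I_n -> 'I_n -> bool) x (i j k l : 'I_n) :
  occ x i j k l -> contains occ x.
Proof.
move=> h; apply/existsP; exists i; apply/existsP; exists j.
by apply/existsP; exists k; apply/existsP; exists l.
Qed.

Lemma contains_3_41_2E x : contains (@occurs_3_41_2 n) x = has_pat desc x.
Proof.
apply/idP/has_patP.
  move=> /existsP[i /existsP[j /existsP[k /existsP[l /andP[/and3P[ij /eqP jk kl] h]]]]].
  by exists (x i), (x j), (x k), (x l); rewrite /pat !pos_perm; lia.
move=> [p [d [a [q h]]]].
apply: (containsI (i := x^-1 p) (j := x^-1 d) (k := x^-1 a) (l := x^-1 q)).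
rewrite /occurs_3_41_2 /vincular (permKV x p) (permKV x d) (permKV x a) (permKV x q).
by move: h; rewrite /pat /pos; lia.
Qed.

Lemma contains_2_41_3E x : contains (@occurs_2_41_3 n) x = has_pat ltn x.
Proof.
apply/idP/has_patP.
  move=> /existsP[i /existsP[j /existsP[k /existsP[l /andP[/and3P[ij /eqP jk kl] h]]]]].
  by exists (x i), (x j), (x k), (x l); rewrite /pat !pos_perm; lia.
move=> [p [d [a [q h]]]].
apply: (containsI (i := x^-1 p) (j := x^-1 d) (k := x^-1 a) (l := x^-1 q)).
rewrite /occurs_2_41_3 /vincular (permKV x p) (permKV x d) (permKV x a) (permKV x q).
by move: h; rewrite /pat /pos; lia.
Qed.

Lemma pat_reverse phi x p d a q : pat phi (reverse x) p d a q =
  [&& pos x q < pos x a, pos x d == (pos x a).+1, pos x d < pos x p,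
      a < p, p < d, a < q, q < d & phi p q].
Proof.
rewrite /pat !pos_reverse_lt !pos_reverse.
(* The bounds keep the truncated subtractions in [pos_reverse] exact. *)
have := (pos_lt x a, pos_lt x d) => -[].
move: (pos x p) (pos x d) (pos x a) (pos x q) => P D A Q ltA ltD.
case: (_ && phi p q) => //; lia.
Qed.

(** Read backwards, [c a d b] is [b d a c], a 2-41-3. *)
Lemma contains_3_14_2E x : contains (@occurs_3_14_2 n) x = has_pat ltn (reverse x).
Proof.
apply/idP/has_patP.
  move=> /existsP[i /existsP[j /existsP[k /existsP[l /andP[/and3P[ij /eqP jk kl] h]]]]].
  by exists (x l), (x k), (x j), (x i); rewrite pat_reverse !pos_perm; lia.
move=> [p [d [a [q h]]]].
apply: (containsI (i := x^-1 q) (j := x^-1 a) (k := x^-1 d) (l := x^-1 p)).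
rewrite /occurs_3_14_2 /vincular (permKV x q) (permKV x a) (permKV x d) (permKV x p).
by move: h; rewrite pat_reverse /pos; lia.
Qed.

Lemma moveE x y : move_3412_3142 x y = step desc y x.
Proof.
apply/idP/stepP.
  move=> /existsP[i /existsP[j /existsP[k /existsP[l /andP[h /eqP->]]]]].
  case/andP: h => /and3P[ij /eqP jk kl] h.
  exists (y i), (y j), (y k), (y l); rewrite /pat !pos_perm /vswap !permK; split=> //; lia.
move=> [p [d [a [q [h ->]]]]].
apply/existsP; exists (y^-1 p); apply/existsP; exists (y^-1 d).
apply/existsP; exists (y^-1 a); apply/existsP; exists (y^-1 q).
rewrite /occurs_3_41_2 /vincular (permKV y p) (permKV y d) (permKV y a) (permKV y q) eqxx andbT.
by move: h; rewrite /pat /pos; lia.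
Qed.

(* Reversing words turns the moves 3-14-2 -> 3-41-2 into 2-41-3 -> 2-14-3, so
   both ends of a class are normal forms of a decreasing rewriting system. *)
Lemma step_reverse x y : step ltn (reverse x) (reverse y) = step desc y x.
Proof.
apply/stepP/stepP => -[p [d [a [q [h]]]]].
  rewrite -reverse_vswap => /(can_inj reverseK)->.
  exists q, d, a, p; rewrite vswapK; split=> //.
  move: h; rewrite pat_reverse => /and4P[qa /eqP adj dp h].
  have ad : pos (vswap x a d) a = (pos (vswap x a d) d).+1.
    by rewrite pos_vswapL pos_vswapR.
  have [ne1 ne2 ne3 ne4] : [/\ p != a :> nat, p != d :> nat, q != a :> nat & q != d :> nat].
    by split; lia.
  by rewrite /pat pos_vswapL pos_vswapR !pos_vswapD //; lia.
move=> ->; exists q, d, a, p; rewrite -reverse_vswap vswapK; split=> //.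
move: h; rewrite pat_reverse => /and4P[pd /eqP adj aq h].
have [ne1 ne2 ne3 ne4] : [/\ p != a :> nat, p != d :> nat, q != a :> nat & q != d :> nat].
  by split; lia.
by rewrite pos_vswapL pos_vswapR !pos_vswapD //; lia.
Qed.

(** * Congruence classes and their ends *)

Lemma ThetaE : @Theta_3412 n =2 connect (fun x y => step desc y x || step desc x y).
Proof. by apply: eq_connect => x y; rewrite !moveE. Qed.

Lemma Theta_sym x y : Theta_3412 x y = Theta_3412 y x.
Proof. by apply: sym_connect_sym => u v; rewrite orbC. Qed.

Lemma steps_Theta y x : connect (step desc) y x -> Theta_3412 y x.
Proof.
rewrite ThetaE; apply: connect_sub => u v uv.
by apply: connect1; rewrite uv orbT.
Qed.

Lemma steps_reverse x y : connect (step ltn) (reverse x) (reverse y) -> connect (step desc) y x.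
Proof.
move=> st; rewrite -[x]reverseK -[y]reverseK; move: st.
apply: (connect_ind (R := fun x y => connect (step desc) (reverse y) (reverse x))).
- by move=> z; apply: connect0.
- by move=> ? ? ? vu wv; apply: connect_trans wv vu.
by move=> ? ? st; apply: connect1; rewrite -step_reverse !reverseK.
Qed.

(** Downward moves keep [w] below by [step_maximal], upward moves by transitivity. *)
Lemma Theta_le_bottom w x y : ~~ has_pat desc w -> Theta_3412 x y ->
  weak_le w x = weak_le w y.
Proof.
move=> nw; rewrite ThetaE; move: x y.
apply: (connect_ind (R := fun x y => weak_le w x = weak_le w y)) => [//||].
  by move=> ? ? ? ->.
have stepE x y : step desc y x -> weak_le w y = weak_le w x.
  move=> st; apply/idP/idP => [|le_wx]; first exact: step_maximal st.
  by have /andP[le_xy _] := step_cover st; apply: weak_le_trans le_xy.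
by move=> x y /orP[] /stepE.
Qed.

Lemma Theta_le_top w x y : ~~ has_pat ltn (reverse w) -> Theta_3412 x y ->
  weak_le x w = weak_le y w.
Proof.
move=> nw; rewrite ThetaE; move: x y.
apply: (connect_ind (R := fun x y => weak_le x w = weak_le y w)) => [//||].
  by move=> ? ? ? ->.
have stepE x y : step desc y x -> weak_le x w = weak_le y w.
  move=> st; apply/idP/idP => [|le_yw].
    by rewrite -!(weak_le_reverse w); apply: (step_maximal nw); rewrite step_reverse.
  by have /andP[le_xy _] := step_cover st; apply: weak_le_trans le_yw.
by move=> x y /orP[] /stepE.
Qed.

(** Since [z] is below itself, [Theta_le_bottom] puts it below its whole class; by antisymmetry it
    is the only candidate of the [pick]. *)
Lemma pi_down_eq x z : Theta_3412 x z -> ~~ has_pat desc z -> pi_down_3412 x = z.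
Proof.
move=> xz nz; have z_min w : Theta_3412 x w -> weak_le z w.
  by move=> xw; rewrite -(Theta_le_bottom nz xw) (Theta_le_bottom nz xz) weak_le_refl.
rewrite /pi_down_3412; case: pickP => [y /andP[xy /forallP y_min]|/(_ z)] /=.
  apply: weak_le_antisym; rewrite z_min // andbT.
  by have := y_min z; rewrite xz.
by rewrite xz /= => /forallP[] t; apply/implyP/z_min.
Qed.

Lemma pi_up_eq x z : Theta_3412 x z -> ~~ has_pat ltn (reverse z) -> pi_up_3412 x = z.
Proof.
move=> xz nz; have z_max w : Theta_3412 x w -> weak_le w z.
  by move=> xw; rewrite -(Theta_le_top nz xw) (Theta_le_top nz xz) weak_le_refl.
rewrite /pi_up_3412; case: pickP => [y /andP[xy /forallP y_max]|/(_ z)] /=.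
  apply: weak_le_antisym; rewrite z_max //=.
  by have := y_max z; rewrite xz.
by rewrite xz /= => /forallP[] t; apply/implyP/z_max.
Qed.

Lemma pi_downP x : connect (step desc) x (pi_down_3412 x) /\ ~~ has_pat desc (pi_down_3412 x).
Proof.
have [z [xz nz]] := steps_normal desc x.
by rewrite (pi_down_eq (steps_Theta xz) nz).
Qed.

Lemma pi_upP x :
  connect (step desc) (pi_up_3412 x) x /\ ~~ has_pat ltn (reverse (pi_up_3412 x)).
Proof.
(* Normalising the reversed word downward climbs to the top of the class of [x]. *)
have [z] := steps_normal ltn (reverse x); rewrite -[z]reverseK.
move: (reverse z) => y [/steps_reverse yx ny].
by rewrite (@pi_up_eq x y) // Theta_sym steps_Theta.
Qed.

Lemma pi_down_up x : ~~ has_pat desc x -> pi_down_3412 (pi_up_3412 x) = x.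
Proof. by move=> nx; apply: pi_down_eq => //; apply/steps_Theta/(pi_upP x).1. Qed.

Lemma pi_up_down x : ~~ has_pat ltn (reverse x) -> pi_up_3412 (pi_down_3412 x) = x.
Proof.
by move=> nx; apply: pi_up_eq; rewrite // Theta_sym; apply/steps_Theta/(pi_downP x).1.
Qed.

Lemma pi_down_homo x y : weak_le x y -> weak_le (pi_down_3412 x) (pi_down_3412 y).
Proof.
move=> le_xy; have [[xx nx] [yy _]] := (pi_downP x, pi_downP y).
by apply: steps_maximal nx yy _; apply: weak_le_trans (steps_le xx) le_xy.
Qed.

Lemma pi_up_homo x y : weak_le x y -> weak_le (pi_up_3412 x) (pi_up_3412 y).
Proof.
move=> le_xy; have [[xx _] [yy ny]] := (pi_upP x, pi_upP y).
rewrite (Theta_le_top ny (steps_Theta xx)).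
exact: weak_le_trans le_xy (steps_le yy).
Qed.

(** * Transfer of 2-41-3 between the ends of a class *)

(** Let [p] be the largest entry before [d] that is less than [q0]. Then [p.+1] is [q0] or, by
    maximality, not before [d]; either way it stands after [a]. *)
Lemma has_2413_consecutive x : has_pat ltn x ->
  exists p d a q, pat ltn x p d a q /\ q = p.+1 :> nat.
Proof.
move=> /has_patP[p0 [d [a [q0 h]]]].
have Q0 : (pos x p0 < pos x d) && (p0 < q0) by move: h; rewrite /pat; lia.
case: (@arg_maxnP _ p0 (fun u => (pos x u < pos x d) && (u < q0)) (@nat_of_ord n) Q0).
move=> p /andP[pd pq] p_max; have p0p := p_max _ Q0.
have lt_n : p.+1 < n by have := ltn_ord q0; lia.
exists p, d, a, (Ordinal lt_n); split=> //.
have := p_max (Ordinal lt_n); have := pos_eq x (Ordinal lt_n) q0.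
have := (pos_eq x (Ordinal lt_n) d, pos_eq x (Ordinal lt_n) a).
by move: h; rewrite /pat /=; move: (pos x (Ordinal _)) => Q h [? ?] ? /(_ _)H; lia.
Qed.

Definition separated x l m h := forall u v,
  l <= u <= m -> m < v <= h -> pos x u < pos x v.

(** An upward move could only break this by swapping [a d] with [a <= m < d]. Its pattern has
    [a < b < c < d]: if [c > m], then [c] before [a] already violates separation in [x]; otherwise
    [b <= m] after [d] does. *)
Lemma separated_steps y x l m h : connect (step desc) y x ->
  separated x l m h -> separated y l m h.
Proof.
apply: (connect_ind (R := fun y x => separated x l m h -> separated y l m h)) => //.
  by move=> u v w uv vw /vw/uv.
move=> {}y {}x /stepP[c [d [a [b [/and4P[cd /eqP adj ab pat_cb] ->]]]]] sep u v ul vh.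
have := sep u v ul vh; rewrite pos_vswap_lt // => /orP[/andP[/eqP ua /eqP vd]|/andP[]//].
have sepE s t : l <= s <= m -> m < t <= h -> t != d :> nat -> s != a :> nat -> pos y s < pos y t.
  move=> sl th td sa; have := sep s t sl th; rewrite pos_vswap_lt //.
  by rewrite (negPf sa) /= => /andP[].
have sepa t : m < t <= h -> t != d :> nat -> pos y a <= pos y t.
  move=> th td; have := sep a t _ th; rewrite -ua ul => /(_ isT).
  by rewrite pos_vswap_lt // (negPf td) andbF /= => /andP[/ltnW].
have sepd s : l <= s <= m -> s != a :> nat -> pos y s <= pos y d.
  move=> sl sa; have := sep s d sl; rewrite -vd vh => /(_ isT).
  by rewrite pos_vswap_lt // (negPf sa) /= => /andP[/ltnW].
by move: pat_cb => /=; have := sepa c; have := sepd b; lia.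
Qed.

(** For [b <= m < c], the last two clauses make [b] the last of the values [b..m] and [c] the first
    of the values [m+1..c]; they make the first clause stable under downward moves. *)
Definition crossed x b m c := [/\ pos x c < pos x b,
  forall t, b < t <= m -> pos x t < pos x b & forall t, m < t < c -> pos x c < pos x t].

(** Each clause puts a larger value first, so only swapping that very pair [d a] breaks it. In the
    pattern [c' d a b'], either [a = b] and [b' <= m], so [b'] should precede [b], or [d = c] and
    [c' > m], so [c'] should follow [c]. *)
Lemma crossed_steps y x b m c : connect (step desc) y x ->
  b <= m < c -> crossed y b m c -> crossed x b m c.
Proof.
move=> yx bmc; move: yx.
apply: (connect_ind (R := fun y x => crossed y b m c -> crossed x b m c)) => //.
  by move=> u v w uv vw /uv/vw.
move=> {}y {}x /stepP[c' [d [a [b' [/and4P[cd /eqP adj ab pat_cb] ->]]]]] [cb mb mc].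
have := (mb c', mb b', mc c', mc b') => -[[[H1 H2] H3] H4].
split=> [|t tb|t tc]; rewrite pos_vswap_lt //; apply/orP; right.
- rewrite cb; apply/negP => /andP[/eqP/val_inj ? /eqP/val_inj ?]; subst; lia.
- rewrite mb //; apply/negP => /andP[/eqP/val_inj ? /eqP/val_inj ?]; subst; lia.
rewrite mc //; apply/negP => /andP[/eqP/val_inj ? /eqP/val_inj ?]; subst; lia.
Qed.

Lemma has_2413_up x y : ~~ has_pat desc x -> connect (step desc) y x ->
  has_pat ltn x -> has_pat ltn y.
Proof.
move=> nx yx /has_2413_consecutive[B [D [A [C [h eq_C]]]]].
case/and4P: h => BD /eqP adj AC /and5P[AB lt_BD lt_AC CD _].
(* A violation [u] gives the 3-41-2 occurrence [B D A u]; below, a violation [v] gives [v D A C]. *)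
have sep1 : separated x A B C.
  move=> u v uB vC; have -> : v = C by apply: val_inj => /=; lia.
  rewrite ltnNge; apply: contra nx => le_Cu; apply/has_patP; exists B, D, A, u.
  have := pos_eq x u C; have := pos_eq x u B; have := pos_eq x u A; rewrite /pat; lia.
have sep2 : separated x B B D.
  move=> u v uB vD; have -> : u = B by apply: val_inj => /=; lia.
  rewrite ltnNge; apply: contra nx => le_vB; apply/has_patP; exists v, D, A, C.
  have := pos_eq x v C; have := pos_eq x v B; have := pos_eq x v D; rewrite /pat; lia.
apply: (@has_pat_gap _ _ B C A D).
- by apply: (separated_steps yx sep2); lia.
- by have := weak_leP _ _ (steps_le yx) A D; lia.
- by apply: (separated_steps yx sep1); lia.
- by rewrite AB.
- by rewrite lt_AC.
- by rewrite /= eq_C.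
(* As [C] is [B + 1], only [B] and [C] could violate the gap condition, and both stand outside. *)
move=> t Dt.
have := separated_steps yx sep1 (u := A) (v := C).
have := separated_steps yx sep2 (u := B) (v := D).
have := pos_eq y t B; have := pos_eq y t C; lia.
Qed.

Lemma has_2413_down y x : ~~ has_pat ltn (reverse y) -> connect (step desc) y x ->
  has_pat ltn y -> has_pat ltn x.
Proof.
move=> ny yx /has_2413_consecutive[B [D [A [C [h eq_C]]]]].
case/and4P: h => BD /eqP adj AC /and5P[AB lt_BD lt_AC CD _].
have QA : (pos y A <= pos y A) && (A < B) by rewrite leqnn.
have QD : (pos y D <= pos y D) && (C < D) by rewrite leqnn.
case: (@arg_maxnP _ A (fun u => (pos y A <= pos y u) && (u < B)) (@nat_of_ord n) QA).
move=> b /andP[Ab lt_bB] b_max.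
case: (@arg_minnP _ D (fun u => (pos y u <= pos y D) && (C < u)) (@nat_of_ord n) QD).
move=> c /andP[cD lt_Cc] c_min.
have {}b_max u : pos y A <= pos y u -> u < B -> u <= b.
  by move=> uA uB; apply: b_max; rewrite uA.
have {}c_min u : pos y u <= pos y D -> C < u -> c <= u.
  by move=> uA uB; apply: c_min; rewrite uA.
have le_Ab := b_max A (leqnn _) AB; have le_cD := c_min D (leqnn _) CD.
(* Otherwise [B .. A .. C .. b] yields a 3-14-2: by the choice of [b], no value of [b..B] stands
   between [A] and [C]. *)
have bC : pos y b < pos y C.
  rewrite ltnNge; apply: contra ny => le_Cb.
  have := (pos_eq y b A, pos_eq y b C) => -[? ?].
  apply: (@has_pat_gap _ _ b B A C); rewrite ?pos_reverse_lt /=; try lia.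
  move=> t; rewrite !pos_reverse_lt => lt_t.
  by have := b_max t; have := pos_eq y t b; have := pos_eq y t B; lia.
(* Otherwise [c .. B .. D .. C] yields a 3-14-2, by the choice of [c]. *)
have Bc : pos y B < pos y c.
  rewrite ltnNge; apply: contra ny => le_cB.
  have := (pos_eq y c D, pos_eq y c B) => -[? ?].
  apply: (@has_pat_gap _ _ C c B D); rewrite ?pos_reverse_lt /=; try lia.
  move=> t; rewrite !pos_reverse_lt => lt_t.
  by have := c_min t; have := pos_eq y t c; have := pos_eq y t C; lia.
have cross : crossed y b B c.
  split=> [|t tB|t tC]; first lia.
    by have := b_max t; have := pos_eq y t B; lia.
  by have := c_min t; have := pos_eq y t C; lia.
have [|cb _ _] := crossed_steps yx _ cross; first lia.
have /weak_leP le_xy := steps_le yx.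
have {}Bc := inv_leNP le_xy _ Bc; have {}bC := inv_leNP le_xy _ bC.
apply: (@has_pat_gap _ _ B C b c); try lia.
by move=> t; have := pos_eq x t B; have := pos_eq x t C; lia.
Qed.

(** * The lattice of twisted Baxter permutations *)

Lemma BaxterE x : (x \in Baxter n) = ~~ has_pat ltn (reverse x) && ~~ has_pat ltn x.
Proof. by rewrite inE contains_3_14_2E contains_2_41_3E. Qed.

Lemma twisted_BaxterE x : (x \in twisted_Baxter n) = ~~ has_pat desc x && ~~ has_pat ltn x.
Proof. by rewrite inE contains_3_41_2E contains_2_41_3E. Qed.

Lemma has_pat_true x : has_pat (fun _ _ => true) x = has_pat desc x || has_pat ltn x.
Proof.
apply/has_patP/orP => [[p [d [a [q h]]]]|[]/has_patP[p [d [a [q h]]]]].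
- have := pos_eq x p q; case: (ltngtP p q) => pq ?.
  + by right; apply/has_patP; exists p, d, a, q; move: h; rewrite /pat; lia.
  + by left; apply/has_patP; exists p, d, a, q; move: h; rewrite /pat; lia.
  by move: h; rewrite /pat; lia.
- by exists p, d, a, q; move: h; rewrite /pat; lia.
by exists p, d, a, q; move: h; rewrite /pat; lia.
Qed.

(** Rewriting with both moves at once, [phi] being always true, ends in the required [z]. *)
Lemma twisted_Baxter_interior y : exists z,
  [/\ z \in twisted_Baxter n, weak_le z y
    & {in twisted_Baxter n, forall w, weak_le w y -> weak_le w z}].
Proof.
have tBE x : (x \in twisted_Baxter n) = ~~ has_pat (fun _ _ => true) x.
  by rewrite twisted_BaxterE has_pat_true negb_or.
have [z [yz nz]] := steps_normal (fun _ _ => true) y.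
exists z; split=> [||w]; rewrite ?tBE //; first exact: steps_le yz.
by move=> nw; apply: steps_maximal yz.
Qed.

Lemma weak_partial_order (A : {set 'S_n}) : is_partial_order_on (@weak_le n) A.
Proof.
split=> [x _|x y _ _|y x z _ _ _]; first exact: weak_le_refl.
  exact: weak_le_antisym.
exact: weak_le_trans.
Qed.

(** The interior of the weak join is still above [x] and [y], which are twisted Baxter; the meet is
    the interior of the weak meet. *)
Lemma twisted_Baxter_lattice : is_lattice_on (@weak_le n) (twisted_Baxter n).
Proof.
split=> [|x y tx ty|x y tx ty]; first exact: weak_partial_order.
  have [j [xj yj jP]] := weak_join x y; have [z [tz zj zP]] := twisted_Baxter_interior j.
  exists z; split=> //; try exact: zP.
  by move=> u _ xu yu; apply: weak_le_trans zj _; apply: jP.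
have [m [mx my mP]] := weak_meet x y; have [z [tz zm zP]] := twisted_Baxter_interior m.
exists z; split=> //; try exact: weak_le_trans zm _.
by move=> u tu ux uy; apply: zP => //; apply: mP.
Qed.
End Perms.

(** * Transport along mutually inverse monotone maps *)

Section InverseIso.

Variables (T : finType) (le : rel T) (A B : {set T}) (f g : T -> T).
Hypotheses (fAB : {in A, forall x, f x \in B}) (gBA : {in B, forall x, g x \in A}).
Hypotheses (fK : {in A, cancel f g}) (gK : {in B, cancel g f}).
Hypotheses (f_homo : {homo f : x y / le x y}) (g_homo : {homo g : x y / le x y}).

Lemma inverse_poset_iso : poset_iso_on le A B f.
Proof.
split=> [||x y Ax Ay]; first exact: can_in_inj fK.
  apply/setP => y; apply/imsetP/idP => [[x Ax ->]|By]; first exact: fAB.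
  by exists (g y); rewrite ?gBA ?gK.
by apply/idP/idP => [/g_homo|/f_homo//]; rewrite !fK.
Qed.

Lemma inverse_iso_lattice :
  is_partial_order_on le A -> is_lattice_on le B -> is_lattice_on le A.
Proof.
move=> poA [_ joinB meetB]; split=> // x y Ax Ay.
  have [z [Bz xz yz zP]] := joinB _ _ (fAB Ax) (fAB Ay); exists (g z).
  split; rewrite ?gBA //; try by rewrite -[X in le X]fK // g_homo.
  by move=> u Au xu yu; rewrite -(fK Au) g_homo // zP ?fAB // f_homo.
have [z [Bz zx zy zP]] := meetB _ _ (fAB Ax) (fAB Ay); exists (g z).
split; rewrite ?gBA //; try by rewrite -[X in le _ X]fK // g_homo.
by move=> u Au ux uy; rewrite -(fK Au) g_homo // zP ?fAB // f_homo.
Qed.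

End InverseIso.

Theorem corollary8p6 (n : nat) (n_ge1 : 1 <= n) :
  [/\ poset_iso_on (@weak_le n) (Baxter n) (twisted_Baxter n) (@pi_down_3412 n),
      poset_iso_on (@weak_le n) (twisted_Baxter n) (Baxter n) (@pi_up_3412 n),
      {in Baxter n, forall x, pi_up_3412 (pi_down_3412 x) = x},
      {in twisted_Baxter n, forall x, pi_down_3412 (pi_up_3412 x) = x}
    & is_lattice_on (@weak_le n) (Baxter n)].
Proof.
have upK : {in Baxter n, cancel (@pi_down_3412 n) (@pi_up_3412 n)}.
  by move=> x; rewrite BaxterE => /andP[/pi_up_down].
have downK : {in twisted_Baxter n, cancel (@pi_up_3412 n) (@pi_down_3412 n)}.
  by move=> x; rewrite twisted_BaxterE => /andP[/pi_down_up].
have downB : {in Baxter n, forall x, pi_down_3412 x \in twisted_Baxter n}.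
  move=> x Bx; have := Bx; rewrite BaxterE twisted_BaxterE => /andP[_ nx].
  (* The bottom avoids 3-41-2 by construction, and a 2-41-3 in it would lift to [x]. *)
  have [_ nd] := pi_downP x; rewrite nd; apply: contra nx.
  by apply: has_2413_up => //; case: (pi_downP x).
have upB : {in twisted_Baxter n, forall x, pi_up_3412 x \in Baxter n}.
  move=> x; rewrite BaxterE twisted_BaxterE => /andP[_ nx].
  have [ux nu] := pi_upP x; rewrite nu; apply: contra nx.
  exact: has_2413_down.
have down_homo : {homo @pi_down_3412 n : x y / weak_le x y} by exact: pi_down_homo.
have up_homo : {homo @pi_up_3412 n : x y / weak_le x y} by exact: pi_up_homo.
split.
- exact: (inverse_poset_iso downB upB upK downK down_homo up_homo).
- exact: (inverse_poset_iso upB downB downK upK up_homo down_homo).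
- exact: upK.
- exact: downK.
exact: (inverse_iso_lattice downB upB upK down_homo up_homo
          (weak_partial_order _) (twisted_Baxter_lattice n)).
Qed.
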